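(* Let $s\ge 3$. There exists an uncountable set of $s$-tuples $\alpha=(\alpha_1,\dots,\alpha_s)\in\mathbb{R}^s$, with $1,\alpha_1,\dots,\alpha_s$ linearly independent over $\mathbb{Z}$, such that $\operatorname{rk} M_\nu[\alpha]\le 3$ for every $\nu\in\mathbb{N}$; in particular $\det M_\nu[\alpha]=0$ for all $\nu$.
   Context: For $\alpha\in\mathbb{R}^s$, a best simultaneous approximation (b.s.a.) is an integer point $\zeta=(p,a_1,\dots,a_s)\in\mathbb{Z}^{s+1}$ such that $D(\zeta):=\max_{j}|p\alpha_j-a_j|<\min^*\max_j|q\alpha_j-b_j|$, where $\min^*$ is over all $1\le q\le p$ and $(b_1,\dots,b_s)\in\mathbb{Z}^s\setminus\{(a_1,\dots,a_s)\}$. When all $\alpha_j\notin\mathbb{Q}$, the b.s.a. form an infinite sequence $\zeta^\nu=(p^\nu,a_1^\nu,\dots,a_s^\nu)$ with $p^1<p^2<\dots$ and $D(\zeta^1)>D(\zeta^2)>\dots$. $M_\nu[\alpha]$ denotes the $(s+1)\times(s+1)$ matrix whose rows are $\zeta^\nu,\zeta^{\nu+1},\dots,\zeta^{\nu+s}$. *)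

(* Defs.v *)
From HB Require Import structures.
From mathcomp Require Import all_boot all_order all_algebra.
From mathcomp Require Import boolp classical_sets cardinality reals.
Set Implicit Arguments. Unset Strict Implicit. Unset Printing Implicit Defensive.
Import Order.TTheory GRing.Theory Num.Theory.
Local Open Scope ring_scope.

Definition Dapprox (R : realType) (s : nat) (alpha : 'I_s -> R)
    (p : int) (a : 'I_s -> int) : R :=
  \big[Num.max/0]_(j < s) `|p%:~R * alpha j - (a j)%:~R|.

Definition bsa (R : realType) (s : nat) (alpha : 'I_s -> R)
    (p : int) (a : 'I_s -> int) : Prop :=
  1 <= p /\
  forall (q : int) (b : 'I_s -> int), 1 <= q -> q <= p ->
    (exists j, b j != a j) -> Dapprox alpha p a < Dapprox alpha q b.

(* zeta is the increasing enumeration zeta^0, zeta^1, ... of all b.s.a.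
   (indexing shifted to start at 0). *)
Definition bsa_enum (R : realType) (s : nat) (alpha : 'I_s -> R)
    (zeta : nat -> int * ('I_s -> int)) : Prop :=
  (forall nu, bsa alpha (zeta nu).1 (zeta nu).2) /\
  (forall nu, (zeta nu).1 < (zeta nu.+1).1) /\
  (forall p a, bsa alpha p a ->
     exists nu, (zeta nu).1 = p /\ forall j, (zeta nu).2 j = a j).

Definition zvec (s : nat) (z : int * ('I_s -> int)) (j : 'I_s.+1) : int :=
  match unlift ord0 j with None => z.1 | Some k => z.2 k end.

Definition Mnu (R : realType) (s : nat) (zeta : nat -> int * ('I_s -> int))
    (nu : nat) : 'M[R]_(s.+1) :=
  \matrix_(i < s.+1, j < s.+1) ((zvec (zeta (nu + i)%N) j)%:~R : R).

Definition Zlinindep1 (R : realType) (s : nat) (alpha : 'I_s -> R) : Prop :=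
  forall (c0 : int) (c : 'I_s -> int),
    c0%:~R + \sum_(j < s) (c j)%:~R * alpha j = 0 ->
    c0 = 0 /\ forall j, c j = 0.

(* Main.v *)
(* Fix [alpha_0 = sqrt 2] and let the other coordinates be limits of rational
   vectors [x_k], where [x_(k+1)] differs from [x_k] by a tiny amount in one
   coordinate [i_k] only.  If [d] is a common denominator of the rational
   coordinates of [x_k], an integer point [(p, a)] with [a_j <> p x_j] for some
   rational coordinate [j] stays at distance at least [1/d], so the b.s.a. of
   points close to [x_k] eventually lie in a 2-dimensional lattice, and those of
   points close to [x_(k+1)] stay in the 3-dimensional lattice obtained by freeing
   coordinate [i_k], up to an arbitrarily large height.  Making [x_(k+2)] close
   enough to [x_(k+1)], we can ensure that the ranges of heights belonging to
   consecutive 3-dimensional lattices overlap in at least [s] b.s.a., so that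
   any [s+1] consecutive b.s.a. lie in one of these lattices.  Each perturbation
   is also used to leave a prescribed hyperplane: in this way all integer
   relations, and any given countable set of points, are avoided. *)
Require Import Defs.
From HB Require Import structures.
From mathcomp Require Import all_boot all_order all_algebra.
From mathcomp Require Import boolp classical_sets cardinality reals.
From mathcomp Require Import zify ring lra.
Set Implicit Arguments. Unset Strict Implicit. Unset Printing Implicit Defensive.
Import Order.TTheory GRing.Theory Num.Theory.
Local Open Scope ring_scope.

(** * Irrational numbers: gaps from the integers and rational approximation *)

Lemma mul_irrational_neq (R : realType) (t : R) (p a : int) :
  irrational t -> p != 0 -> p%:~R * t != a%:~R.
Proof.
move=> irr p0; apply: contra_notN irr => /eqP E.
exists (a%:~R / p%:~R) => //.
rewrite fmorph_div /= !ratr_int -E mulrC mulKf ?intr_eq0 //.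
Qed.

Lemma irrational_sqrt2 (R : realType) : irrational (Num.sqrt 2 : R).
Proof.
move=> [q _ E].
have q2 : q ^+ 2 = 2.
  apply: (fmorph_inj (@ratr R)).
  by rewrite rmorphXn /= E sqr_sqrtr ?ler0n // rmorph_nat.
have d0 : (denq q != 0) by rewrite denq_neq0.
have Z : (numq q) ^+ 2 = 2 * denq q ^+ 2.
  by apply/eqP; rewrite -(eqr_int rat) intrM !rmorphXn /= numqE exprMn q2.
have {}Z : (`|numq q| ^ 2 = 2 * `|denq q| ^ 2)%N.
  by rewrite -!abszX Z abszM.
have dn : (0 < `|denq q|)%N by rewrite absz_gt0.
have := congr1 (logn 2) Z; rewrite lognM ?expn_gt0 ?dn // !lognX (@logn_prime 2 2) //.
lia.
Qed.

Lemma irrational_gap (R : realType) (x : R) : irrational x ->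
  exists2 eta : R, 0 < eta & forall a : int, eta <= `|x - a%:~R|.
Proof.
move=> irr.
have ne a : x != a%:~R by have := @mul_irrational_neq R x 1 a irr isT; rewrite mul1r.
have /andP[l u] := floor_itv x.
have {}l : (Num.floor x)%:~R < x by rewrite lt_neqAle l andbT eq_sym ne.
exists (Num.min (x - (Num.floor x)%:~R) ((Num.floor x + 1)%:~R - x)).
  by rewrite lt_min !subr_gt0 l u.
move=> a; rewrite ge_min.
have [h|h] := leP a (Num.floor x).
  have {}h : (a%:~R : R) <= (Num.floor x)%:~R by rewrite ler_int.
  by apply/orP; left; rewrite ger0_norm; lra.
have {}h : ((Num.floor x + 1)%:~R : R) <= a%:~R by rewrite ler_int lezD1.
by apply/orP; right; rewrite ler0_norm; lra.
Qed.

Lemma irrationalMz (R : realType) (t : R) (p : int) :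
  irrational t -> p != 0 -> irrational (p%:~R * t).
Proof.
move=> irr p0 [q _ E]; apply: irr; exists (q / p%:~R) => //.
by rewrite fmorph_div /= ratr_int E mulrC mulKf ?intr_eq0.
Qed.

Lemma irrational_gap_upto (R : realType) (t : R) (T : nat) : irrational t ->
  exists2 eta : R, 0 < eta &
    forall p a : int, 1 <= p -> p <= T -> eta <= `|p%:~R * t - a%:~R|.
Proof.
move=> irr; elim: T => [|T [e e0 IH]]; first by exists 1 => // p a; lia.
have [f f0 gap] := irrational_gap (@irrationalMz R t T.+1 irr isT).
exists (Num.min e f); first by rewrite lt_min e0 f0.
move=> p a p1 pT; rewrite ge_min.
have [->|ne] := eqVneq p (Posz T.+1); first by rewrite gap orbT.
by rewrite IH //; lia.
Qed.

(* One step of the Euclidean algorithm on (1, |q t - b|) halves the remainder. *)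
Lemma irrational_approx_halve (R : realType) (t : R) (n : nat) : irrational t ->
  exists2 q : int, q != 0 & exists b : int, `|q%:~R * t - b%:~R| <= 2^-1 ^+ n.
Proof.
move=> irr; elim: n => [|n [q q0 [b qb]]].
  exists 1 => //; exists (Num.floor t); rewrite mul1r expr0.
  have /andP[] := floor_itv t; rewrite intrD => l u.
  by rewrite ger0_norm; lra.
pose x := `|q%:~R * t - b%:~R|.
have x0 : 0 < x by rewrite normr_gt0 subr_eq0 mul_irrational_neq.
have [sg sgE] : exists sg : int, sg != 0 /\ x = sg%:~R * (q%:~R * t - b%:~R).
  rewrite /x; have [h|h] := leP 0 (q%:~R * t - b%:~R).
    by exists 1; rewrite mul1r ger0_norm.
  by exists (-1); rewrite ltr0_norm // mulN1r.
case: sgE => sg0 xE.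
have xle : x <= 1 by apply: le_trans qb _; rewrite exprn_ile1 //; lra.
pose m := Num.floor x^-1.
have /andP[ml mu] := floor_itv x^-1; rewrite -/m intrD in ml mu.
have m1 : 1 <= m by rewrite floor_ge_int -[1%:~R]/1 invf_ge1.
have m_gt0 : 0 < m := lt_le_trans ltr01 m1.
have ml' : m%:~R * x <= 1 by rewrite -ler_pdivlMr // mul1r.
have mu' : 1 < (m%:~R + 1) * x by rewrite -ltr_pdivrMr // mul1r.
have xn : x <= 2^-1 ^+ n by [].
rewrite exprS.
(* The candidate remainders [1 - m x] and [(m + 1) x - 1] are nonnegative and add up to [x], so one
   of them is at most [x / 2]. *)
have [h|h] := leP (1 - m%:~R * x) (x / 2).
  exists (m * sg * q); first by rewrite !mulf_neq0 // gt_eqF.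
  exists (m * sg * b + 1); rewrite intrD !intrM.
  have -> : m%:~R * sg%:~R * q%:~R * t - (m%:~R * sg%:~R * b%:~R + 1%:~R)
     = - (1 - m%:~R * x) by rewrite xE; ring.
  by rewrite normrN ger0_norm; lra.
exists ((m + 1) * sg * q); first by rewrite !mulf_neq0 // gt_eqF // addr_gt0.
exists ((m + 1) * sg * b + 1); rewrite intrD !intrM intrD.
have -> : (m%:~R + 1%:~R) * sg%:~R * q%:~R * t - ((m%:~R + 1%:~R) * sg%:~R * b%:~R + 1%:~R)
     = (m%:~R + 1) * x - 1 by rewrite xE; ring.
by rewrite ger0_norm; lra.
Qed.

Lemma irrational_approx (R : realType) (t eta : R) : irrational t -> 0 < eta ->
  exists2 q : int, 1 <= q & exists b : int, `|q%:~R * t - b%:~R| < eta.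
Proof.
move=> irr eta0.
have [n ne] : exists n, 2^-1 ^+ n < eta.
  exists (Num.bound eta^-1); rewrite exprVn invf_plt ?posrE ?exprn_gt0 //.
  apply: lt_trans (archi_boundP _) _; first by rewrite invr_ge0 ltW.
  by rewrite -natrX ltr_nat ltn_expl.
have [q q0 [b qb]] := irrational_approx_halve n irr.
have [h|h] := leP 1 q; first by exists q => //; exists b; apply: le_lt_trans qb ne.
exists (- q); first lia.
exists (- b); rewrite !mulrNz mulNr -opprD normrN.
exact: le_lt_trans qb ne.
Qed.

(** * Elementary properties of best simultaneous approximations *)

Section BestApproximations.
Context {R : realType} {s : nat}.
Implicit Types (alpha x : 'I_s -> R) (p q : int) (a b : 'I_s -> int).

Lemma Dapprox_ge alpha p a j : `|p%:~R * alpha j - (a j)%:~R| <= Dapprox alpha p a.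
Proof. exact: (le_bigmax 0 (fun j => `|p%:~R * alpha j - (a j)%:~R|)). Qed.

Lemma Dapprox_le alpha p a y : 0 <= y ->
  (forall j, `|p%:~R * alpha j - (a j)%:~R| <= y) -> Dapprox alpha p a <= y.
Proof. by move=> y0 h; apply: bigmax_le. Qed.

Lemma eq_Dapprox alpha p a b : a =1 b -> Dapprox alpha p a = Dapprox alpha p b.
Proof. by move=> ab; apply: eq_bigr => j _; rewrite ab. Qed.

Lemma Dapprox_ge0 alpha p a : 0 <= Dapprox alpha p a.
Proof. by rewrite /Dapprox; elim/big_ind: _ => // u v u0 v0; rewrite le_max u0. Qed.

Lemma Dapprox_double alpha p a :
  Dapprox alpha (2 * p) (fun j => 2 * a j) <= 2 * Dapprox alpha p a.
Proof.
have D0 := Dapprox_ge0 alpha p a.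
apply: Dapprox_le => [|j]; first lra.
have := Dapprox_ge alpha p a j.
by rewrite !ler_norml !intrM => /andP[l u]; apply/andP; split; lra.
Qed.

(** The integer vector nearest to [p alpha] competes at height [p], so [a] either equals it or beats
    it. *)
Lemma bsa_le_half alpha p a : bsa alpha p a -> Dapprox alpha p a <= 2^-1.
Proof.
move=> [p1 h]; pose b j := Num.floor (p%:~R * alpha j + 2^-1).
have Db : Dapprox alpha p b <= 2^-1.
  apply: Dapprox_le => [|j]; first lra.
  have /andP[] := floor_itv (p%:~R * alpha j + 2^-1); rewrite intrD -/(b j) => l u.
  by rewrite ler_norml; apply/andP; split; lra.
have [[j bj]|/forallNP ab] := pselect (exists j, b j != a j).
  by apply: le_trans Db; apply: ltW; apply: h => //; exists j.
by rewrite -(@eq_Dapprox alpha p b a) // => j; apply/eqP/negP => /negP /ab.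
Qed.

Lemma Dapprox_half_unique alpha p a b :
  Dapprox alpha p a < 2^-1 -> Dapprox alpha p b < 2^-1 -> a =1 b.
Proof.
move=> ha hb j; have := Dapprox_ge alpha p a j; have := Dapprox_ge alpha p b j.
move=> /le_lt_trans /(_ hb); rewrite ltr_norml => /andP[bl bu].
move=> /le_lt_trans /(_ ha); rewrite ltr_norml => /andP[al au].
have l : ((a j - b j)%:~R : R) < 1%:~R by rewrite intrB; lra.
have u : ((b j - a j)%:~R : R) < 1%:~R by rewrite intrB; lra.
by move: l u; rewrite !ltr_int; lia.
Qed.

(** Descent on the height: a point that is not a b.s.a. has a competitor at least as good, and below
    [1/2] the uniqueness of the numerators makes the height drop strictly. *)
Lemma exists_bsa_below alpha q b : 1 <= q -> Dapprox alpha q b < 2^-1 ->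
  exists p a, [/\ bsa alpha p a, p <= q & Dapprox alpha p a <= Dapprox alpha q b].
Proof.
move=> q1; have [n qn] : exists n : nat, q <= n by exists `|q|%N; lia.
elim: n => [|n IH] in q b q1 qn *; first lia.
move=> Dq; have [hb|nb] := pselect (bsa alpha q b); first by exists q, b.
have [q' [b' [q'1 q'q nbb DD]]] : exists q' b', [/\ 1 <= q', q' <= q,
    exists j, b' j != b j & Dapprox alpha q' b' <= Dapprox alpha q b].
  apply: contrapT => no; apply: nb; split=> // q' b' h1 h2 h3.
  by rewrite ltNge; apply/negP => h4; apply: no; exists q', b'.
have Dq' := le_lt_trans DD Dq.
have [E|ne] := eqVneq q' q.
  rewrite E in DD Dq'; case: nbb => j.
  by rewrite (@Dapprox_half_unique alpha q b' b) // eqxx.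
have [|p [a [pa pq Dp]]] := IH q' b' q'1 _ Dq'; first lia.
by exists p, a; split=> //; [lia | exact: le_trans DD].
Qed.

(* The definition of [bsa] does not compare [(p, a)] with [(q, a)], [q < p];
   doubling provides a competitor with another numerator vector. *)
Lemma bsa_lt_double alpha p a q b j : bsa alpha p a -> 1 <= q -> 2 * q <= p ->
  b j != 0 -> Dapprox alpha p a < 2 * Dapprox alpha q b.
Proof.
move=> [p1 h] q1 qp bj.
(* If [b j = a j], then [2 * b j] differs from [a j] because [b j != 0]. *)
have [E|ne] := eqVneq (b j) (a j).
  apply: lt_le_trans (Dapprox_double alpha q b); apply: h; [lia|lia|].
  by exists j; rewrite -E; lia.
apply: (@lt_le_trans _ _ (Dapprox alpha q b)).
  by apply: h; [lia|lia|exists j].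
have := Dapprox_ge0 alpha q b; lra.
Qed.

End BestApproximations.

(** * Nested intervals *)

Lemma nested_interval (R : realType) (x e : nat -> R) : (forall k, 0 <= e k) ->
  (forall k, `|x k.+1 - x k| + e k.+1 <= e k) ->
  exists y, forall k, `|y - x k| <= e k.
Proof.
move=> e0 nest.
have far k m : `|x (k + m)%N - x k| + e (k + m)%N <= e k.
  elim: m => [|m IH]; first by rewrite addn0 subrr normr0 add0r.
  rewrite addnS; have := nest (k + m)%N.
  have := ler_distD (x (k + m)%N) (x (k + m).+1) (x k); lra.
have ub k m : x k - e k <= x m + e m.
  have := far k m; have := far m k; rewrite addnC.
  have := ler_norm (x (k + m)%N - x m); have := ler_norm (x k - x (k + m)%N).
  by rewrite (distrC (x k)); have := e0 (k + m)%N; lra.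
pose S := [set z | exists k, z = x k - e k]%classic.
exists (sup S) => k; rewrite ler_distl; apply/andP; split.
  apply: ub_le_sup; last by exists k.
  by exists (x k + e k) => _ [m ->]; exact: ub.
by apply: ge_sup; [exists (x k - e k), k | move=> _ [m ->]; exact: ub].
Qed.

(** * Heights and rank of windows of consecutive b.s.a *)

Section Window.
Context {R : realType} {s : nat}.
Implicit Types (alpha x : 'I_s.+1 -> R) (p q Y X : int) (a b : 'I_s.+1 -> int).

(** Counts heights: once some b.s.a. has height at most [Y], at least [m] of them have heights in
    [(Y, X]]. *)
Definition reaches alpha (m : nat) Y X : Prop :=
  forall zeta, bsa_enum alpha zeta ->
    forall nu, (zeta nu).1 <= Y -> (zeta (nu + m)%N).1 <= X.

(** Only [p], [a ord0] and [a i] stay free: a linear space of dimension at most 3, projectively a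
    plane. *)
Definition on_plane x (i : 'I_s.+1) p a : Prop :=
  forall j, j != ord0 -> j != i -> (a j)%:~R = p%:~R * x j.

Lemma bsa_enum_mono alpha zeta : bsa_enum alpha zeta ->
  {homo (fun nu => (zeta nu).1) : m n / (m <= n)%N >-> m <= n}.
Proof.
move=> [_ [inc _]]; apply: homo_leq; [exact: lexx|exact: le_trans|].
by move=> nu; apply: ltW.
Qed.

Lemma reaches1 alpha Y p a : bsa alpha p a -> Y < p -> reaches alpha 1 Y p.
Proof.
move=> pa Yp zeta en nu nuY; have mono := bsa_enum_mono en.
have [_ [_ /(_ _ _ pa) [mu [mup _]]]] := en.
rewrite -mup addn1; apply: (bsa_enum_mono en); rewrite ltnNge; apply/negP.
by move=> /(bsa_enum_mono en) /=; lia.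
Qed.

(** Every column is a combination of the three free ones, so the matrix factors through dimension
    3. *)
Lemma rank_on_plane x i zeta nu :
  (forall k, (k <= s.+1)%N -> on_plane x i (zeta (nu + k)%N).1 (zeta (nu + k)%N).2) ->
  (\rank (Mnu R zeta nu) <= 3)%N.
Proof.
move=> h.
pose N : 'M[R]_(s.+2, 3) := \matrix_(r, k)
  let z := zeta (nu + r)%N in
  (if k == 0 then z.1 else if k == 1 then z.2 ord0 else z.2 i)%:~R.
pose B : 'M[R]_(3, s.+2) := \matrix_(k, j)
  match unlift ord0 j with
  | None => (k == 0)%:R
  | Some l => if l == ord0 then (k == 1)%:R else if l == i then (k == 2)%:R
              else (k == 0)%:R * x l
  end.
suff -> : Mnu R zeta nu = N *m B by apply: mulmx_max_rank.
apply/matrixP => r j; rewrite !mxE !big_ord_recl big_ord0 !mxE /zvec /=.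
case: unliftP => [l _|_]; last by rewrite /= !mulr0 !addr0 mulr1.
case: eqP => [->|/eqP l0] /=; first by rewrite !mulr0 mulr1 add0r !addr0.
case: eqP => [->|/eqP li] /=; first by rewrite !mulr0 mulr1 !add0r !addr0.
by rewrite (h r (ltnSE (ltn_ord r)) l l0 li) !mul0r mul1r !mulr0 !addr0.
Qed.

End Window.

(** * One stage of the construction: perturbing a point with rational coordinates *)

Section Construction.
Context {R : realType} {s : nat} (t : R).
Hypotheses (t_irr : irrational t) (t_gt1 : 1 < t).
Implicit Types (alpha x : 'I_s.+1 -> R) (p q Y X d : int) (a b : 'I_s.+1 -> int).

(** Coordinate [ord0] is held exactly at [t], so that one irrational gap serves all points of the
    box. *)
Definition box x e alpha : Prop :=
  alpha ord0 = t /\ forall j, `|alpha j - x j| <= e.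

Definition common_denominator x d : Prop :=
  1 <= d /\ forall j, j != ord0 -> exists m : int, d%:~R * x j = m%:~R.

Lemma box_le x e e' alpha : e <= e' -> box x e alpha -> box x e' alpha.
Proof. by move=> ee [a0 h]; split=> // j; apply: le_trans ee. Qed.

(** At heights [q * d] the rational coordinates of [x] are met exactly; [q] is chosen to bring
    [q d t] close to an integer. *)
Lemma good_approx_near x d eta : common_denominator x d -> 0 < eta ->
  exists q b, [/\ 1 <= q, b ord0 != 0 & exists2 e, 0 < e &
    forall alpha, box x e alpha -> Dapprox alpha q b < eta].
Proof.
move=> [d1 /(_ _) den] eta0.
have [m mE] : exists m : 'I_s.+1 -> int, forall j, j != ord0 -> d%:~R * x j = (m j)%:~R.
  have /choice[m mE] : forall j, exists m : int, j != ord0 -> d%:~R * x j = m%:~R.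
    by move=> j; have [->|/den[m ?]] := eqVneq j ord0; [exists 0|exists m].
  by exists m.
(* Having [eta' < 1 < q d t] forces [b ord0 != 0], as the doubling argument requires. *)
pose eta' := Num.min eta 1 / 2.
have eta'0 : 0 < eta' by rewrite divr_gt0 // lt_min eta0 ltr01.
have [eta'l eta'1] : eta' < eta /\ eta' < 1.
  have : Num.min eta 1 <= eta by rewrite ge_min lexx.
  have : Num.min eta 1 <= 1 by rewrite ge_min lexx orbT.
  rewrite /eta' in eta'0 *; lra.
have dirr : irrational (d%:~R * t) by apply: irrationalMz => //; lia.
have [q q1 [b0 qb]] := irrational_approx dirr eta'0.
have qd1 : 1 <= q * d by nia.
have qdR : 1 <= ((q * d)%:~R : R) by rewrite ler1z.
exists (q * d), (fun j => if j == ord0 then b0 else q * m j); split=> //.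
  apply/eqP => /= b00; move: qb; rewrite b00 subr0 mulrA -intrM.
  have : 1 < (q * d)%:~R * t by rewrite (lt_le_trans t_gt1) // ler_peMl // ?(ltW (lt_trans ltr01 t_gt1)).
  by move=> h; rewrite ger0_norm; lra.
exists (eta' / (q * d)%:~R); first by rewrite divr_gt0 //; lra.
move=> alpha [al0 al]; apply: bigmax_lt => // j _.
have [->|j0] := eqVneq j ord0.
  by rewrite al0 intrM -mulrA (lt_trans qb).
rewrite intrM [(q * m j)%:~R]intrM -mE // -mulrA -!mulrBr mulrA -intrM normrM.
apply: le_lt_trans eta'l; rewrite mulrC (ger0_norm (_ : 0 <= (q * d)%:~R)); last lra.
by rewrite -ler_pdivlMr //; lra.
Qed.

(** A b.s.a. with error below the gap of [t] up to height [X] must lie above [X], and a good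
    approximation near [x] yields one of bounded height. Each such round adds one to [m]. *)
Lemma reaches_near x d (m : nat) Y : common_denominator x d ->
  exists X, exists2 e, 0 < e &
    forall alpha, box x e alpha -> reaches alpha m Y X.
Proof.
move=> den; elim: m => [|m [X [e e0 h]]].
  by exists Y, 1 => // alpha _ zeta _ nu; rewrite addn0.
have [eta eta0 gap] := irrational_gap_upto `|X| t_irr.
have eta2 : 0 < Num.min eta 2^-1 by rewrite lt_min eta0 invr_gt0 ltr0n.
have [q [b [q1 _ [e' e'0 near]]]] := good_approx_near den eta2.
exists q, (Num.min e e'); first by rewrite lt_min e0.
move=> alpha bx.
have /h rX : box x e alpha by apply: box_le bx; rewrite ge_min lexx.
have /near : box x e' alpha by apply: box_le bx; rewrite ge_min lexx orbT.
rewrite lt_min => /andP[D1 D2].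
have [p [a [pa pq Dp]]] := exists_bsa_below q1 D2.
have Xp : X < p.
  rewrite ltNge; apply/negP => pX; have := Dapprox_ge alpha p a ord0.
  have [p1 _] := pa; have [-> _] := bx.
  have := gap p (a ord0) p1 (le_trans pX (lez_abs X)); lra.
move=> zeta en nu nuY; apply: le_trans pq; rewrite addnS -(addn1 (nu + m)%N).
exact: (reaches1 pa Xp en (rX _ en _ nuY)).
Qed.

Lemma affine_neq0_near x (c0 : R) (c : 'I_s.+1 -> R) :
  c0 + \sum_j c j * x j != 0 ->
  exists2 e, 0 < e &
    forall alpha, box x e alpha -> c0 + \sum_j c j * alpha j != 0.
Proof.
set v := _ + _ => v0; pose C := 1 + \sum_j `|c j|.
have C0 : 0 < C by rewrite ltr_pwDl // sumr_ge0.
have v_gt0 : 0 < `|v| by rewrite normr_gt0.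
exists (`|v| / (2 * C)); first by rewrite divr_gt0 ?mulr_gt0.
move=> alpha [_ al]; apply/eqP => z.
have : `|v| <= (C - 1) * (`|v| / (2 * C)).
  have vE : v = \sum_j c j * (x j - alpha j).
    have -> : v = v - (c0 + \sum_j c j * alpha j) by rewrite z subr0.
    rewrite /v opprD addrACA subrr add0r -sumrB.
    by apply: eq_bigr => j _; rewrite mulrBr.
  rewrite {1}vE /C addrAC subrr add0r mulr_suml; apply: le_trans (ler_norm_sum _ _ _) _.
  apply: ler_sum => j _; by rewrite normrM ler_wpM2l // distrC.
have -> : (C - 1) * (`|v| / (2 * C)) = `|v| / 2 - `|v| / (2 * C) by field; lra.
have : 0 < `|v| / (2 * C) by rewrite divr_gt0 ?mulr_gt0.
lra.
Qed.

(* [d] is meant to be a common denominator of [x]: a bound below [1/d] forces a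
   b.s.a. of height at least [Y] into the lattice of [x]. *)
Definition captured x e Y d : Prop :=
  [/\ 0 < e, x ord0 = t, common_denominator x d &
    forall alpha p a, box x e alpha -> bsa alpha p a -> Y <= p ->
      Dapprox alpha p a <= (2 * d%:~R)^-1].

(** If the form vanishes at [x], moving coordinate [i] by [1/N] changes it by [c i / N], and [d * N]
    is a new common denominator. *)
Lemma perturb_coordinate x e d (c0 : R) (c : 'I_s.+1 -> R) i :
  0 < e -> common_denominator x d -> i != ord0 -> c i != 0 ->
  exists x' d', [/\ common_denominator x' d', forall j, j != i -> x' j = x j,
    `|x' i - x i| <= e & c0 + \sum_j c j * x' j != 0].
Proof.
move=> e0 [d1 den] i0 ci.
have [z|nz] := eqVneq (c0 + \sum_j c j * x j) 0; last first.
  by exists x, d; rewrite subrr normr0 ltW.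
pose N := Num.bound e^-1.
have N0 : 0 < (N%:R : R).
  by apply: le_lt_trans (archi_boundP _); rewrite invr_ge0 ltW.
have Ne : N%:R^-1 <= e.
  by rewrite -[leRHS]invrK lef_pV2 ?posrE ?invr_gt0 // ltW // archi_boundP // invr_ge0 ltW.
exists (fun j => x j + (if j == i then N%:R^-1 else 0)), (d * N); split.
- split; first by move: N0; rewrite ltr0n; nia.
  move=> j /den[m mE]; rewrite intrM mulrDr mulrAC mE -mulrA.
  case: eqP => _; last by exists (m * N); rewrite intrM mulr0 mulr0 addr0.
  by exists (m * N + d); rewrite mulfV ?gt_eqF // mulr1 intrD intrM.
- by move=> j /negPf ->; rewrite addr0.
- by rewrite eqxx addrAC subrr add0r ger0_norm // invr_ge0 ltW.
rewrite (eq_bigr (fun j => c j * x j + (if j == i then c j * N%:R^-1 else 0))); last first.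
  by move=> j _; rewrite mulrDr; case: eqP => // _; rewrite mulr0.
rewrite big_split /= addrA z add0r -big_mkcond big_pred1_eq.
by rewrite mulf_neq0 // invr_eq0 gt_eqF.
Qed.

(** The difference is a nonzero integer multiple of [1/d]. *)
Lemma far_off_plane x d j p (k : int) : common_denominator x d -> j != ord0 ->
  k%:~R != p%:~R * x j -> d%:~R^-1 <= `|p%:~R * x j - k%:~R|.
Proof.
move=> [d1 den] /den [m mE] ne.
have dR : 0 < (d%:~R : R) by rewrite ltr0z; lia.
rewrite -[d%:~R^-1]mul1r ler_pdivrMr //.
have -> : `|p%:~R * x j - k%:~R| * d%:~R = `|p * m - k * d|%:~R.
  rewrite -{1}(gtr0_norm dR) -normrM intr_norm intrB !intrM -mE; congr `|_|; ring.
rewrite -[1]/(1%:~R) ler_int -gtz0_ge1 normr_gt0 subr_eq0; apply: contra ne => /eqP E.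
apply/eqP/(mulfI (lt0r_neq0 dR)).
by rewrite mulrCA mE -!intrM mulrC E.
Qed.

(** The plane comes from the old point [x], while [X] is counted for the new point [x']. As only
    coordinate [i] has moved, the other rational coordinates still tie b.s.a. to [x] up to height
    [X]. A window starting between [Y] and [Y'] thus stays in one plane. *)
Lemma stage_step x e Y d (c0 : R) (c : 'I_s.+1 -> R) i :
  captured x e Y d -> i != ord0 -> c i != 0 ->
  exists x' e' Y' d', [/\ captured x' e' Y' d', Y + 1 <= Y',
    forall j, `|x' j - x j| + e' <= e,
    forall alpha, box x' e' alpha -> c0 + \sum_j c j * alpha j != 0 &
    exists X, forall alpha, box x' e' alpha -> reaches alpha s.+1 Y' X /\
      forall p a, bsa alpha p a -> Y <= p -> p <= X -> on_plane x i p a].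
Proof.
move=> [e0 xt den cap] i0 ci.
have e20 : 0 < e / 2 by lra.
have [x' [d' [den' x'E x'i nz]]] := perturb_coordinate c0 e20 den i0 ci.
have [d'1 _] := den'; have d'R : 1 <= (d'%:~R : R) by rewrite ler1z.
have [d1 _] := den; have dR : 1 <= (d%:~R : R) by rewrite ler1z.
have eta0 : 0 < (4 * d'%:~R)^-1 :> R by rewrite invr_gt0; lra.
have [q [b [q1 b0 [e1 e10 near1]]]] := good_approx_near den' eta0.
(* The term [2 * q] serves the doubling argument, the rest makes heights grow. *)
pose Y' := 2 * q + `|Y| + 1.
have [X [e2 e20' near2]] := reaches_near s.+1 Y' den'.
have [e3 e30 near3] := affine_neq0_near nz.
pose K : R := (1 + `|X|)%:~R.
have K1 : 1 <= K by rewrite /K ler1z lerDl.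
(* Up to height [X], an error [e4] in a coordinate moves its multiple by at most [1/(4d)]. *)
pose e4 := (4 * d%:~R * K)^-1.
have e40 : 0 < e4 by rewrite invr_gt0 !mulr_gt0 //; lra.
have [e' [e'0 e'e e'1 e'2 [e'3 e'4]]] :
    exists e', [/\ 0 < e', e' <= e / 2, e' <= e1, e' <= e2 & e' <= e3 /\ e' <= e4].
  exists (Num.min (e / 2) (Num.min e1 (Num.min e2 (Num.min e3 e4)))).
  by rewrite !lt_min !ge_min !lexx !orbT e20 e10 e20' e30 e40.
have shift j : `|x' j - x j| + e' <= e.
  have [->|ji] := eqVneq j i; first lra.
  by rewrite x'E // subrr normr0; lra.
exists x', e', Y', d'; split=> //.
- split=> //; first by rewrite x'E // eq_sym.
  move=> alpha p a /(box_le e'1) /near1 Db pa Yp.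
  apply: ltW; apply: lt_trans (bsa_lt_double pa q1 _ b0) _; first by move: Yp; rewrite /Y'; clear; lia.
  have : (2 * d'%:~R)^-1 = 2 * (4 * d'%:~R)^-1 :> R by field; lra.
  lra.
- by move: q1; rewrite /Y'; clear; lia.
- by move=> alpha /(box_le e'3); apply: near3.
exists X => alpha bx; split; first exact: near2 (box_le e'2 bx).
move=> p a pa Yp pX j j0 ji; apply/eqP; apply: contraT => ne.
have [p1 _] := pa.
have bxe : box x e alpha.
  have [a0 al] := bx; split=> // l; apply: le_trans (shift l).
  by have := al l; have := ler_distD (x' l) (alpha l) (x l); lra.
have := far_off_plane den j0 ne.
have := cap _ _ _ bxe pa Yp; have := Dapprox_ge alpha p a j.
have : `|p%:~R * x j - p%:~R * alpha j| <= (4 * d%:~R)^-1.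
  have [_ /(_ j)] := bx; rewrite x'E // => al.
  rewrite -mulrBr normrM distrC.
  have -> : (4 * d%:~R)^-1 = K * e4 by rewrite /e4; field; lra.
  apply: ler_pM => //; last exact: le_trans e'4.
  by rewrite -intr_norm ler_int; move: p1 pX; clear; lia.
(* The errors [1/(4d)] and [1/(2d)] add up to less than the distance [1/d] off the plane. *)
have := ler_distD (p%:~R * alpha j) (p%:~R * x j) (a j)%:~R.
have -> : (4 * d%:~R)^-1 = d%:~R^-1 / 4 :> R by field; lra.
have -> : (2 * d%:~R)^-1 = d%:~R^-1 / 2 :> R by field; lra.
have : 0 < d%:~R^-1 :> R by rewrite invr_gt0; lra.
lra.
Qed.

(** * Iterating the stages and passing to the limit *)

Lemma captured_start : captured (fun j => if j == ord0 then t else 0) 1 0 1.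
Proof.
(* For [d = 1] the bound is [1/2], which every b.s.a. satisfies. *)
split=> //; last by move=> alpha p a _ /bsa_le_half; rewrite mulr1.
by split=> // j /negPf ->; exists 0; rewrite mulr0.
Qed.

Lemma degenerate_avoiding (c0 : nat -> R) (c : nat -> 'I_s.+1 -> R) :
  (forall k, exists2 i, i != ord0 & c k i != 0) ->
  exists alpha, [/\ alpha ord0 = t,
    forall k, c0 k + \sum_j c k j * alpha j != 0 &
    forall zeta, bsa_enum alpha zeta -> forall nu, (\rank (Mnu R zeta nu) <= 3)%N].
Proof.
move=> cne.
(* (point, radius, height, denominator) *)
pose stage : Type := (('I_s.+1 -> R) * R * int * int)%type.
pose ok (u : stage) := captured u.1.1.1 u.1.1.2 u.1.2 u.2.
pose next k (u v : stage) := [/\ u.1.2 + 1 <= v.1.2,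
    forall j, `|v.1.1.1 j - u.1.1.1 j| + v.1.1.2 <= u.1.1.2,
    forall alpha, box v.1.1.1 v.1.1.2 alpha -> c0 k + \sum_j c k j * alpha j != 0 &
    exists i X, forall alpha, box v.1.1.1 v.1.1.2 alpha ->
      reaches alpha s.+1 v.1.2 X /\
      forall p a, bsa alpha p a -> u.1.2 <= p -> p <= X -> on_plane u.1.1.1 i p a].
have /choice[f fE] : forall ku : nat * stage, exists v, ok ku.2 -> ok v /\ next ku.1 ku.2 v.
  (* Off [ok] the function is given the arbitrary value [u]. *)
  move=> [k u]; have [/= oku|] := pselect (ok u); last by exists u.
  have [i i0 ci] := cne k.
  have [x' [e' [Y' [d' [h1 h2 h3 h4 [X hX]]]]]] := stage_step (c0 k) oku i0 ci.
  by exists (x', e', Y', d'); split=> //; split=> //; exists i, X.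
pose st := fix st k : stage := if k is k'.+1 then f (k', st k') else
  ((fun j => if j == ord0 then t else 0), 1, 0, 1).
have stok k : ok (st k).
  by elim: k => [|k /(fE (k, _))[]//]; exact: captured_start.
have stnext k : next k (st k) (st k.+1) by have [] := fE (k, st k) (stok k).
have /choice[y yE] j : exists y, forall k, `|y - (st k).1.1.1 j| <= (st k).1.1.2.
  apply: nested_interval => k; first by have [/ltW] := stok k.
  by have [_ /(_ j)] := stnext k.
(* Coordinate [ord0] is set to [t] outright, since [box] demands equality there. *)
pose alpha j := if j == ord0 then t else y j.
have inbox k : box (st k).1.1.1 (st k).1.1.2 alpha.
  split=> [|j]; first by rewrite /alpha eqxx.
  rewrite /alpha; case: eqP => [->|_] //.
  by have [/ltW e0 -> _ _] := stok k; rewrite subrr normr0.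
exists alpha; split; first by rewrite /alpha eqxx.
  by move=> k; have [_ _ h _] := stnext k; exact: h (inbox _).
move=> zeta en nu; set p := (zeta nu).1.
have p1 : 1 <= p by have [/(_ nu)[]] := en.
(* Stage heights start at 0 and grow without bound, so [p] falls between two consecutive ones; the
   window then ends below the [X] of that stage. *)
have [k [kl ku]] : exists k, (st k).1.2 <= p /\ p <= (st k.+1).1.2.
  have grow k : k%:Z <= (st k).1.2.
    elim: k => // k IH; have [h _ _ _] := stnext k.
    by apply: le_trans h; rewrite -addn1 PoszD lerD2r.
  have : p <= (st `|p|%N).1.2 := le_trans (lez_abs p) (grow _).
  elim: `|p|%N => [|k IH pk]; first by move=> /(le_trans p1) /=.
  by have [/IH//|lt] := leP p (st k).1.2; exists k; rewrite (ltW lt).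
have [_ _ _ [i [X /(_ _ (inbox _)) [rX pl]]]] := stnext k.
apply: (@rank_on_plane _ _ (st k).1.1.1 i) => m ms.
have mono := bsa_enum_mono en.
apply: pl; first by have [] := en.
  by apply: le_trans kl _; apply: mono; apply: leq_addr.
by apply: le_trans (rX _ en _ ku); apply: mono; rewrite leq_add2l.
Qed.

End Construction.

(** * Uncountability and linear independence *)

Theorem theorem2p1 (R : realType) (s : nat) (hs : (3 <= s)%N) :
  exists A : set ('I_s -> R),
    ~ countable A /\
    forall alpha, A alpha ->
      Zlinindep1 alpha /\
      forall zeta : nat -> int * ('I_s -> int), bsa_enum alpha zeta ->
        forall nu : nat, (\rank (Mnu R zeta nu) <= 3)%N /\ \det (Mnu R zeta nu) = 0.
Proof.
case: s hs => [//|s] hs.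
pose t : R := Num.sqrt 2; have t_irr : irrational t := @irrational_sqrt2 R.
have t_gt1 : 1 < t by rewrite -sqrtr1 ltr_sqrt ?ltr0n ?ltr1n.
pose A : set ('I_s.+1 -> R) := [set alpha | Zlinindep1 alpha /\
  forall zeta, bsa_enum alpha zeta -> forall nu, (\rank (Mnu R zeta nu) <= 3)%N]%classic.
exists A; split; last first.
  move=> alpha [lin rk]; split=> // zeta en nu; have rk3 := rk zeta en nu.
  (* With [s] now lowered by one, a nonsingular matrix would have rank [s + 2], at least 4 by
     [hs]. *)
  split=> //; apply/eqP; apply: contraTT rk3 => d0.
  by rewrite mxrank_unit ?unitmxE ?unitfE // -ltnNge ltnS.
move=> /countable_injP[g ginj].
have [i1 i10] : exists i : 'I_s.+1, i != ord0.
  by have h : (1 < s.+1)%N by [lia]; exists (Ordinal h).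
(* The coordinate [i1] of the point of [A] numbered [n], or 0 if there is none. *)
have /choice[y yE] n : exists y : R, forall alpha, A alpha -> g alpha = n -> alpha i1 = y.
  have [[beta [Ab gb]]|no] := pselect (exists beta, A beta /\ g beta = n).
    exists (beta i1) => alpha Aa ga; congr (_ i1).
    by apply: ginj; rewrite ?inE // ga.
  by exists 0 => alpha Aa ga; case: no; exists alpha.
(* [inl n] avoids the hyperplane [alpha i1 = y n] through the [n]-th point of [A],
   [inr (c0, c)] avoids an integer relation. *)
pose I : countType := (nat + int * {ffun 'I_s.+1 -> int})%type.
pose phi0 (w : I) : R := match w with inl n => - y n | inr z => z.1%:~R end.
pose phi (w : I) j : R := match w with
  | inl n => (j == i1)%:R
  | inr z => if [exists i, (i != ord0) && (z.2 i != 0)] then (z.2 j)%:~R else (j == i1)%:R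
  end.
pose w k : I := odflt (inl 0%N) (unpickle k).
have [k|alpha [al0 av rk]] :=
    degenerate_avoiding t_irr t_gt1 (phi0 \o w) (c := phi \o w).
  rewrite /=; case: (w k) => [n|z] /=; first by exists i1; rewrite ?eqxx ?oner_neq0.
  (* A relation between 1 and [t] alone has no coefficient off [ord0]; [phi] substitutes a dummy
     form, and the irrationality of [t] excludes the relation below. *)
  case: existsP => [[i /andP[i0 zi]]|_]; first by exists i; rewrite ?intr_eq0.
  by exists i1; rewrite ?eqxx ?oner_neq0.
have {}av v : phi0 v + \sum_j phi v j * alpha j != 0.
  by have := av (pickle v); rewrite /= /w pickleK.
have Aal : A alpha.
  split=> // c0 c rel.
  have cj j : j != ord0 -> c j = 0.
    move=> j0; apply/eqP; apply: contraT => cj0.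
    have := av (inr (c0, [ffun j => c j])) => /=.
    have -> : [exists i, (i != ord0) && ([ffun j => c j] i != 0)].
      by apply/existsP; exists j; rewrite j0 ffunE.
    under eq_bigr do rewrite ffunE.
    by rewrite rel eqxx.
  have rel0 : c0%:~R + (c ord0)%:~R * t = 0.
    rewrite -rel (bigD1 ord0) //= al0 big1 ?addr0 // => j j0.
    by rewrite cj // mul0r.
  have c00 : c ord0 = 0.
    apply/eqP; apply: contraT => /(mul_irrational_neq (- c0) t_irr) /eqP[].
    by rewrite intrN; lra.
  split; last by move=> j; have [->|/cj] := eqVneq j ord0.
  by apply/eqP; rewrite -(intr_eq0 R) -rel0 c00 mul0r addr0.
(* Lying in [A], the new point is on the hyperplane carrying its own number, which it was built to
   avoid. *)
have := av (inl (g alpha)); rewrite /= (bigD1 i1) //= eqxx mul1r big1 => [|j /negPf->].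
  by rewrite addr0 (yE _ _ Aal erefl) addNr eqxx.
by rewrite mul0r.
Qed.
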